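(* For each $n\in\mathbb{N}$ such that $n\geqslant 2$, there is a finite non-commutative Clifford semigroup whose commuting graph has clique number equal to $n$.
   Context: A semigroup $S$ is a Clifford semigroup if it is equipped with a unary operation $x\mapsto x^{-1}$ such that for all $x,y\in S$: $(x^{-1})^{-1}=x$, $xx^{-1}x=x$, $x^{-1}x=xx^{-1}$, and $(xx^{-1})(yy^{-1})=(yy^{-1})(xx^{-1})$. Equivalently, $S$ is regular and all its idempotents are central. The center of $S$ is $Z(S)=\{x\in S: xy=yx \text{ for all } y\in S\}$. The commuting graph of a finite non-commutative semigroup $S$ is the simple graph with vertex set $S\setminus Z(S)$ in which two distinct vertices $x,y$ are adjacent if and only if $xy=yx$. The clique number of a finite simple graph is the maximum size of a set of pairwise adjacent vertices. *)

(* Defs.v *)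
From HB Require Import structures.
From mathcomp Require Import all_boot.

Set Implicit Arguments.
Unset Strict Implicit.
Unset Printing Implicit Defensive.

Import Algebra.
Local Open Scope group_scope.

#[short(type="finSemigroupType")]
HB.structure Definition FinSemigroup := {S of Semigroup S & Finite S}.

Definition clifford_inverse (S : semigroupType) (inv : S -> S) : Prop :=
  [/\ forall x, inv (inv x) = x,
      forall x, x * inv x * x = x,
      forall x, inv x * x = x * inv x
    & forall x y, (x * inv x) * (y * inv y) = (y * inv y) * (x * inv x)].

Definition clifford (S : semigroupType) : Prop :=
  exists inv : S -> S, clifford_inverse inv.

Definition center (S : finSemigroupType) : {set S} :=
  [set x | [forall y, x * y == y * x]].

Record sgraph := SGraph {
  vertex : finType;
  adj : rel vertex;
  adj_sym : symmetric adj;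
  adj_irrefl : irreflexive adj
}.

Definition clique (G : sgraph) (A : {set vertex G}) : bool :=
  [forall u in A, forall v in A, (u != v) ==> adj u v].

Definition clique_number (G : sgraph) : nat :=
  \max_(A : {set vertex G} | clique A) #|A|.

Section CommutingGraph.
Variable S : finSemigroupType.

Definition noncentral : finType := {x : S | x \notin center S}.

Definition commuting_adj : rel noncentral :=
  fun u v => (u != v) && (val u * val v == val v * val u).

Lemma commuting_adj_sym : symmetric commuting_adj.
Proof. by move=> u v; rewrite /commuting_adj eq_sym [X in _ && X]eq_sym. Qed.

Lemma commuting_adj_irrefl : irreflexive commuting_adj.
Proof. by move=> u; rewrite /commuting_adj eqxx. Qed.

Definition commuting_graph : sgraph :=
  SGraph commuting_adj_sym commuting_adj_irrefl.

End CommutingGraph.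

(* Main.v *)
Require Import Defs.
From HB Require Import structures.
From mathcomp Require Import all_boot all_order all_fingroup cyclic.

(** Let G be a group of order 6 with an involution t outside its center. In the
  strong semilattice of groups over the chain 0 < 1 < ... < k whose component
  is G at 0 and H = <[t]> elsewhere, with inclusions as connecting maps, two
  elements commute iff their G-coordinates do. Hence the k + 1 copies of t are
  pairwise commuting, and non-central. Conversely, non-central elements
  commuting with one of G-coordinate g have their G-coordinate in the
  centralizer of g, whose order is 2 or 3: in the first case they are copies of
  g, and in the second case their G-coordinates have order 3, so they lie in
  the component at 0 and there are at most two of them. *)

Set Implicit Arguments.
Unset Strict Implicit.
Unset Printing Implicit Defensive.

Import Order.TTheory.

Section ChainOfGroups.
Variables (gT : finGroupType) (H : {group gT}) (k : nat).
Local Open Scope group_scope.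

(** Since the connecting maps are inclusions, the strong semilattice embeds in the direct product of
    [gT] with the chain under [min], so its multiplication is coordinatewise. *)
Definition chain_pred (x : gT * 'I_k.+1) : bool :=
  (x.2 == ord0) || (x.1 \in H).

Definition chain : Type := {x : gT * 'I_k.+1 | chain_pred x}.
HB.instance Definition _ := Finite.on chain.

Implicit Types x y : chain.

Definition chain_op (x y : gT * 'I_k.+1) : gT * 'I_k.+1 :=
  (x.1 * y.1, Order.min x.2 y.2).

Lemma chain_mul_subproof x y : chain_pred (chain_op (val x) (val y)).
Proof.
case: x y => [[g i] /= gi] [[h j] /= hj]; move: gi hj; rewrite /chain_pred /=.
case: (eqVneq i ord0) => [-> _ _|_ /= gH].
  by apply/orP; left; apply/eqP/min_idPl; rewrite leEord.
case: (eqVneq j ord0) => [-> _|_ /= hH]; last by rewrite groupM ?orbT.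
by apply/orP; left; apply/eqP/min_idPr; rewrite leEord.
Qed.

Definition chain_mul x y : chain := Sub _ (chain_mul_subproof x y).

Lemma chain_mulA : associative chain_mul.
Proof.
move=> x y z; apply: val_inj.
by rewrite /= /chain_op /= mulgA minA.
Qed.

HB.instance Definition _ := isSemigroup.Build chain chain_mulA.

Lemma chain_inv_subproof x : chain_pred ((val x).1^-1, (val x).2).
Proof. by rewrite /chain_pred /= groupV; exact: (valP x). Qed.

Definition chain_inv x : chain := Sub _ (chain_inv_subproof x).

Lemma chain_clifford : clifford chain.
Proof.
exists chain_inv; split=> [x|x|x|x y]; apply: val_inj;
  rewrite /= /chain_op /= ?mulgV ?mulVg ?mul1g ?invgK ?minxx //.
- by case: (val x).
- by case: (val x).
- by rewrite minC.
Qed.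

Lemma chain_commuteE x y :
  (x * y == y * x) = ((val x).1 * (val y).1 == (val y).1 * (val x).1).
Proof.
by rewrite -val_eqE /= /chain_op xpair_eqE minC eqxx andbT.
Qed.

Definition chain_bottom (g : gT) : chain := Sub (g, ord0) isT.

(** The component at 0 is a full copy of the group, so commuting with it already tests against every
    group element. *)
Lemma chain_centerE x : (x \in center chain) = ((val x).1 \in 'C([set: gT])).
Proof.
rewrite inE; apply/forallP/centP => [xZ|xZ y].
  move=> g _; apply/eqP.
  by have := xZ (chain_bottom g); rewrite chain_commuteE.
by rewrite chain_commuteE; apply/eqP/xZ.
Qed.

Notation vertices := (noncentral chain).

Definition coord (u : vertices) : gT * 'I_k.+1 := val (val u).

Lemma coord_inj : injective coord.
Proof. by move=> u v /val_inj/val_inj. Qed.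

Lemma coord_noncentral (u : vertices) : (coord u).1 \notin 'C([set: gT]).
Proof. by rewrite -chain_centerE; exact: (valP u). Qed.

Lemma clique_commute (A : {set vertices}) (u v : vertices) :
    @clique (commuting_graph chain) A -> u \in A -> v \in A ->
  (coord u).1 * (coord v).1 = (coord v).1 * (coord u).1.
Proof.
move=> /'forall_implyP/(_ u) cA uA vA.
have [-> //|uv] := eqVneq u v.
have /'forall_implyP/(_ v vA) := cA uA.
by rewrite uv /= => /andP[_]; rewrite chain_commuteE => /eqP.
Qed.

Hypotheses (oG : #|gT| = 6) (oH : #|H| = 2).

(** By Lagrange the order divides 6. It is not 1, as [g] lies in its own centralizer and would be
    trivial, and not 6, as [g] would be central. *)
Lemma card_cent1_noncentral (g : gT) :
  g \notin 'C([set: gT]) -> #|'C[g]| = 2 \/ #|'C[g]| = 3.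
Proof.
move=> gZ.
have dv : #|'C[g]| %| 6.
  by rewrite -oG -cardsT; apply: cardSg; apply: subsetT.
have n1 : #|'C[g]| != 1%N.
  apply: contraNneq gZ => /eqP; rewrite -trivg_card1 => /eqP C1.
  by have := cent1id g; rewrite C1 => /set1P ->; exact: group1.
have n6 : #|'C[g]| != 6.
  apply: contra gZ => /eqP C6; have CT : 'C[g] = [set: gT].
    by apply/eqP; rewrite eqEcard subsetT cardsT oG C6.
  by apply/centP=> h _; apply/esym/cent1P; rewrite CT.
have : #|'C[g]| \in divisors 6 by rewrite -dvdn_divisors.
by rewrite !inE (negPf n1) (negPf n6) orbF /= => /orP[] /eqP; [left|right].
Qed.

Lemma card_clique (A : {set vertices}) :
  0 < k -> @clique (commuting_graph chain) A -> #|A| <= k.+1.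
Proof.
move=> k_gt0 cA.
have [->|[u uA]] := set_0Vmem A; first by rewrite cards0.
set g := (coord u).1.
(* The identity is removed because it is central. *)
have AC v : v \in A -> (coord v).1 \in 'C[g]^#.
  move=> vA; rewrite in_setD1; apply/andP; split; last first.
    by apply/cent1P; exact: (clique_commute cA).
  by apply: contraNneq (coord_noncentral v) => ->; exact: group1.
have cardC1 : #|'C[g]^#| = #|'C[g]|.-1 by rewrite [in RHS](cardsD1 1) group1.
have [C2|C3] := card_cent1_noncentral (coord_noncentral u).
(* All members share the group coordinate [h], so their indices in the chain tell them apart. *)
- have /cards1P[h Ch] : #|'C[g]^#| == 1%N by rewrite cardC1 C2.
  rewrite -[leqRHS]card_ord.
  rewrite -(card_in_imset (f := fun v => (coord v).2)) ?max_card //.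
  move=> v w /AC + /AC; rewrite Ch => /set1P v1 /set1P w1 vw2.
  by apply: coord_inj; rewrite [coord v]surjective_pairing v1 vw2 -w1
    -surjective_pairing.
(* By coprimality [H] meets the centralizer trivially, and above index 0 only elements of [H]
   occur. *)
- have A0 v : v \in A -> (coord v).2 = ord0.
    move=> /AC; rewrite in_setD1 => /andP[v1 vC]; apply/eqP.
    have /orP[//|vH] : chain_pred (coord v) by exact: (valP (val v)).
    have : coprime #|H| #|'C[g]| by rewrite oH C3.
    move=> /coprime_TIg tiHC; have : (coord v).1 \in H :&: 'C[g].
      by rewrite inE vH.
    by rewrite tiHC => /set1P v1'; rewrite v1' eqxx in v1.
  rewrite -(card_in_imset (f := fun v => (coord v).1)).
    (* The bound is now 2, which is at most [k.+1] because [0 < k]. *)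
    apply: leq_trans (_ : #|'C[g]^#| <= _); last by rewrite cardC1 C3.
    by apply/subset_leq_card/subsetP=> _ /imsetP[v /AC vC ->].
  move=> v w /A0 v2 /A0 w2 vw1.
  by apply: coord_inj; rewrite [coord v]surjective_pairing vw1 v2 -w2
    -surjective_pairing.
Qed.

Lemma clique_copies (t : gT) : t \in H -> t \notin 'C([set: gT]) ->
  exists2 A, @clique (commuting_graph chain) A & #|A| = k.+1.
Proof.
move=> tH tZ.
have tiP i : chain_pred (t, i) by rewrite /chain_pred tH orbT.
pose x i : chain := Sub (t, i) (tiP i).
have xP i : x i \notin center chain by rewrite chain_centerE.
pose u i : vertices := Sub (x i) (xP i).
have u_inj : injective u by move=> i j /(congr1 coord)[].
exists [set u i | i : 'I_k.+1]; last by rewrite card_imset // card_ord.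
apply/'forall_implyP=> _ /imsetP[i _ ->].
apply/'forall_implyP=> _ /imsetP[j _ ->].
by apply/implyP=> uij; rewrite /= /commuting_adj uij chain_commuteE eqxx.
Qed.

Lemma clique_number_chain (t : gT) : 0 < k -> t \in H ->
  t \notin 'C([set: gT]) -> clique_number (commuting_graph chain) = k.+1.
Proof.
move=> k_gt0 tH tZ; apply/eqP; rewrite eqn_leq; apply/andP; split.
  by apply/bigmax_leqP=> A; exact: card_clique.
by have [A cA <-] := clique_copies tH tZ; exact: leq_bigmax_cond.
Qed.

Lemma chain_noncommutative (t : gT) :
  t \notin 'C([set: gT]) -> ~ commutative (@mul chain).
Proof.
move=> tZ chainC; case/negP: tZ; apply/centP=> g _; apply/eqP.
have := chain_commuteE (chain_bottom t) (chain_bottom g).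
by rewrite chainC eqxx.
Qed.

End ChainOfGroups.

(** The two products with [tperm b c] send [a] to [c] and to [b] respectively. *)
Lemma tperm_noncentral (T : finType) (a b c : T) :
  a != b -> a != c -> b != c -> tperm a b \notin 'C([set: {perm T}])%g.
Proof.
move=> ab ac bc; apply/negP=> /centP/(_ (tperm b c) (in_setT _)).
move=> /permP/(_ a); rewrite !permM tpermL (tpermD (z := a)) 1?eq_sym //.
by rewrite !tpermL => cb; rewrite cb eqxx in bc.
Qed.

Theorem theorem4p5 (n : nat) (hn : 2 <= n) :
  exists S : finSemigroupType,
    [/\ clifford S,
        ~ commutative (@mul S)
      & clique_number (commuting_graph S) = n].
Proof.
(* With [n] equal to [k.+1], the hypothesis [2 <= n] is [0 < k] by conversion. The group will be the
   symmetric group on three points. *)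
case: n hn => // k k_gt0.
pose a : 'I_3 := inord 0; pose b : 'I_3 := inord 1; pose c : 'I_3 := inord 2.
have tZ : tperm a b \notin 'C([set: {perm 'I_3}])%g.
  by apply: (@tperm_noncentral _ a b c); rewrite -val_eqE /= !inordK.
have o_t : #[tperm a b]%g = 2.
  apply: nt_prime_order => //; first by rewrite expgS expg1 tperm2.
  by apply: contraNneq tZ => ->; exact: group1.
exists (chain <[tperm a b]>%G k); split.
- exact: chain_clifford.
- exact: chain_noncommutative tZ.
- apply: clique_number_chain tZ => //; last exact: cycle_id.
  by rewrite card_Sn.
Qed.
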